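(* Let $r>0$, let $$W^{(r)}(e^{i\theta})=\begin{bmatrix}(1+r^2)^{1/2}& re^{i\theta}\\ re^{-i\theta}&(1+r^2)^{1/2}\end{bmatrix},\qquad w^{(r)}(\gamma)=\sqrt{W^{(r)}(\gamma)},$$ and let $S:\mathbb{T}\to\mathbb{T}$, $S(\gamma)=\overline{\gamma}$. The interpolation family $\{\widetilde{E}^{(r)}_\gamma=\ell^2_{(w^{(r)}\circ S)(\gamma)}:\gamma\in\mathbb{T}\}$ is a rearrangement of the family $\{E^{(r)}_\gamma=\ell^2_{w^{(r)}(\gamma)}:\gamma\in\mathbb{T}\}$ (through the measure preserving map $S$), and the identity mapping $Id:\widetilde{E}^{(r)}[0]\to E^{(r)}[0]$ has norm $$\big\|Id:\widetilde{E}^{(r)}[0]\to E^{(r)}[0]\big\|=(1+r^2)^{1/2}.$$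
   Context: $\mathbb{D}$ is the open unit disc, $\mathbb{T}$ the unit circle with normalized Lebesgue measure. For $A\in GL_N(\mathbb{C})$, $\ell^2_A=(\mathbb{C}^N,\|\cdot\|_A)$ with $\|x\|_A=\|Ax\|_{\ell_2^N}$ (here $N=2$). For a family of norms $E_\gamma=(\mathbb{C}^N,\|\cdot\|_\gamma)$, $\gamma\in\mathbb{T}$, measurable in $\gamma$ and uniformly equivalent to the Euclidean norm, the interpolated space $E[0]$ is $\mathbb{C}^N$ with norm $\|x\|_{E[0]}=\inf\{\operatorname{ess\,sup}_{\gamma}\|f(\gamma)\|_{\gamma}\}$, the infimum over bounded analytic $f:\mathbb{D}\to\mathbb{C}^N$ with $f(0)=x$ ($f(\gamma)$ being the boundary values). *)

(* Defs.v *)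
From HB Require Import structures.
From mathcomp Require Import all_boot all_order all_algebra.
From mathcomp Require Import sesquilinear spectral complex.
From mathcomp Require Import all_classical all_reals all_analysis.
From mathcomp Require Import measurable_realfun ess_sup_inf.

Set Implicit Arguments.
Unset Strict Implicit.
Unset Printing Implicit Defensive.

Import Order.TTheory GRing.Theory Num.Theory numFieldNormedType.Exports.

Local Open Scope complex_scope.
Local Open Scope sesquilinear_scope.
Local Open Scope classical_set_scope.
Local Open Scope ring_scope.

(* The topology of the complex numbers is found on the regular module R[i]^o,
   hence the casts to R[i]^o below. *)

Section unit_circle.
Variable R : realType.

Definition unit_circle := {z : R[i] | `|z| == 1}.

Lemma expi_subproof (t : R) : `|cos t +i* sin t| == 1.
Proof. by rewrite -[`|_|]/((Num.sqrt _)%:C) cos2Dsin2 sqrtr1. Qed.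

Definition expi (t : R) : unit_circle :=
  exist (fun z : R[i] => `|z| == 1) _ (expi_subproof t).

HB.instance Definition _ := Choice.on unit_circle.
HB.instance Definition _ := isPointed.Build unit_circle (expi 0).

Definition circle_open : set (set unit_circle) :=
  [set val @^-1` U | U in (open : set (set R[i]^o))].

(* the unit circle with its Borel sigma-algebra *)
Definition circle := g_sigma_algebraType circle_open.
HB.instance Definition _ := Measurable.on circle.

Definition expi_circle (t : measurableTypeR R) : circle := expi t.

Lemma continuous_expi : continuous (fun t : R => cos t +i* sin t : R[i]^o).
Proof.
move=> t; apply/cvgrPdist_lt => e e0.
have [er er0 e_re] : exists2 d : R, 0 < d & d%:C = e.
  by case: e e0 => a b; rewrite ltcE/= => /andP[/eqP -> a0]; exists a.
have d20 : 0 < er / 2 by rewrite divr_gt0.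
have /cvgrPdist_lt/(_ _ d20) cc := @continuous_cos R t.
have /cvgrPdist_lt/(_ _ d20) cs := @continuous_sin R t.
apply: filterS2 cc cs => x hc hs.
have -> : (cos t +i* sin t - (cos x +i* sin x)) =
  (cos t - cos x)%:C + 'i%C * (sin t - sin x)%:C by simpc.
rewrite -e_re (le_lt_trans (ler_normD _ _))// normrM !normc_def/=.
rewrite !expr0n/= expr1n !(addr0, add0r) !sqrtr_sqr sqrtr1 mul1r.
by rewrite -rmorphD ltcR [ltRHS]splitr ltrD.
Qed.

Lemma measurable_expi : measurable_fun setT expi_circle.
Proof.
have mE : @measurable _ circle = <<s circle_open >> by [].
refine (@measurability _ _ _ circle setT expi_circle circle_open mE _).
move=> _ [_ [U oU <-] <-].
rewrite setTI; apply: open_measurable.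
by move/continuousP : continuous_expi => /(_ _ oU).
Qed.

HB.instance Definition _ :=
  isMeasurableFun.Build _ _ _ _ expi_circle measurable_expi.

(* normalized Lebesgue measure: the law of exp(it), t uniform on [0, 2pi] *)
Definition circle_prob : probability circle R :=
  distribution (uniform_prob (mulr_gt0 (ltr0Sn R 1) (pi_gt0 R))) expi_circle.

Lemma conj_circle_subproof (z : unit_circle) : `|conjc (val z)| == 1.
Proof. by rewrite normcJ (valP z). Qed.

Definition conj_circle (z : circle) : circle :=
  exist (fun z : R[i] => `|z| == 1) _ (conj_circle_subproof z).

Definition measure_preserving (S : circle -> circle) :=
  measurable_fun setT S /\
  forall A, measurable A -> circle_prob (S @^-1` A) = circle_prob A.

End unit_circle.

Section interpolation.
Variables (R : realType) (N : nat).
Implicit Types (x : 'cV[R[i]]_N) (A : 'M[R[i]]_N)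
  (E : circle R -> 'cV[R[i]]_N -> R).

Definition norm2 x : R := Num.sqrt (\sum_i Normc.normc (x i 0) ^+ 2).

Definition ell2 A x : R := norm2 (A *m x).

Definition is_norm (p : 'cV[R[i]]_N -> R) :=
  [/\ forall x y, p (x + y) <= p x + p y,
      forall (a : R[i]) x, p (a *: x) = Normc.normc a * p x &
      forall x, p x = 0 -> x = 0].

Definition interpolation_family E :=
  [/\ forall g, is_norm (E g),
      forall x, measurable_fun setT (fun g => E g x) &
      exists c C : R, [/\ 0 < c, 0 < C &
        forall g x, c * norm2 x <= E g x <= C * norm2 x]].

Definition rearrangement (S : circle R -> circle R) E' E :=
  measure_preserving S /\ forall g, E' g = E (S g).

(* Functions on the open unit disc are total functions on R[i] whose values
   outside the disc are irrelevant. *)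
Definition bounded_analytic (f : R[i] -> 'cV[R[i]]_N) :=
  (forall z i, `|z| < 1 ->
     derivable ((fun u => f u i 0) : R[i]^o -> R[i]^o) z 1) /\
  exists M : R, forall z, `|z| < 1 -> norm2 (f z) <= M.

(* fb is the boundary function of f, as a radial limit almost everywhere; by
   Fatou's theorem every bounded analytic f has one, unique up to null sets. *)
Definition boundary_values (f : R[i] -> 'cV[R[i]]_N)
    (fb : circle R -> 'cV[R[i]]_N) :=
  {ae circle_prob R, forall g, forall i,
     (f (t%:C * val g) i 0 : R[i]^o) @[t --> (1 : R)^'-]
       --> (fb g i 0 : R[i]^o)}.

Definition interp0 E x : \bar R :=
  ereal_inf [set M | exists f fb,
    [/\ bounded_analytic f, boundary_values f fb, f 0 = x &
        M = ess_sup (circle_prob R) (fun g => (E g (fb g))%:E)]].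

Definition opnorm (p q : 'cV[R[i]]_N -> \bar R)
    (T : 'cV[R[i]]_N -> 'cV[R[i]]_N) : \bar R :=
  ereal_sup [set q (T x) | x in [set x | (p x <= 1)%E]].

(* the order of R[i] makes 0 <= z mean that z is real and nonnegative *)
Definition psdmx A :=
  A \is hermsymmx /\ forall x, 0 <= (x ^t* *m A *m x) 0 0.

(* the positive semidefinite square root (0 if there is none) *)
Definition sqrtmx A : 'M[R[i]]_N := xget 0 [set B | psdmx B /\ B *m B = A].

End interpolation.

Section weights.
Variables (R : realType) (r : R).

(* with g = e^(it), e^(-it) is the conjugate of g *)
Definition W (g : circle R) : 'M[R[i]]_2 :=
  let d := (Num.sqrt (1 + r ^+ 2))%:C in
  \matrix_(i < 2, j < 2)
    if i == j then d
    else if i == 0 then r%:C * val g else r%:C * conjc (val g).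

Definition w (g : circle R) : 'M[R[i]]_2 := sqrtmx (W g).

Definition E (g : circle R) : 'cV[R[i]]_2 -> R := ell2 (w g).

Definition Etilde (g : circle R) : 'cV[R[i]]_2 -> R :=
  ell2 ((w \o @conj_circle R) g).

End weights.

(* Main.v *)
(* Write d = sqrt (1 + r^2). On the unit circle W = F^* F, where
   F(z) = [[sqrt d, r z / sqrt d], [0, 1 / sqrt d]] is a polynomial in z with
   determinant 1. Hence f |-> F f turns the infimum defining E[0] into one over
   bounded analytic functions with the constant Euclidean norm on the circle, so
   ||x||_{E[0]} = ||F(0) x||, that is ||x||^2 = d |x_0|^2 + |x_1|^2 / d.
   Replacing z by its conjugate in W amounts to swapping the coordinates, so the
   norm of Etilde[0] is the same with x_0 and x_1 exchanged, and the ratio of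
   the two norms is largest at x = (1, 0), where it equals d.

   That no bounded analytic f beats the constant F f = F(0) x is the mean value
   property of the scalar function <F f, F(0) x> together with Fatou's lemma
   for its radial limits. Complex differentiability is only assumed pointwise,
   so the mean value property is obtained by Goursat's bisection in logarithmic
   polar coordinates z = e^(t + i s), in which circles are vertical segments. *)
From HB Require Import structures.
Require Import Defs.
From mathcomp Require Import all_boot all_order all_algebra.
From mathcomp Require Import sesquilinear spectral complex.
From mathcomp Require Import all_classical all_reals all_analysis.
From mathcomp Require Import ring lra measurable_realfun ess_sup_inf.

Set Implicit Arguments.
Unset Strict Implicit.
Unset Printing Implicit Defensive.
Set Bullet Behavior "Strict Subproofs".

Import Order.TTheory GRing.Theory Num.Theory numFieldNormedType.Exports.

Local Open Scope complex_scope.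
Local Open Scope sesquilinear_scope.
Local Open Scope classical_set_scope.
Local Open Scope ring_scope.

Import complex Normc.

(** * Goursat's theorem for closed forms on rectangles *)

Section interval_integral.
Variable R : realType.
Local Notation mu := (@lebesgue_measure R).
Implicit Types (f g : R -> R) (a b c e : R).

Lemma continuous_itv_integrable f a b :
  (forall x, a <= x <= b -> {for x, continuous f}) ->
  mu.-integrable `[a, b] (EFin \o f).
Proof.
move=> fc; apply: continuous_compact_integrable; first exact: segment_compact.
by apply: continuous_in_subspaceT => x; rewrite inE/= in_itv/= => /fc.
Qed.

Lemma Rintegral_itv_split f a c b : a <= c -> c <= b ->
  (forall x, a <= x <= b -> {for x, continuous f}) ->
  \int[mu]_(x in `[a, b]) f x =
  \int[mu]_(x in `[a, c]) f x + \int[mu]_(x in `[c, b]) f x.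
Proof.
move=> ac cb fc.
have /(Rintegral_itvB (x := c)) : mu.-integrable `[a, b] (EFin \o f).
  exact: continuous_itv_integrable.
rewrite !bnd_simp => /(_ ac cb)/(canRL (subrK _)) ->.
rewrite addrC Rintegral_itv_obnd_cbnd//.
apply: (@integrableS _ _ _ mu `[a, b]) => //.
  by apply: subset_itvr; rewrite bnd_simp.
exact: continuous_itv_integrable.
Qed.

Lemma Rintegral_itv_near_cst f a b c e : a <= b ->
  (forall x, a <= x <= b -> {for x, continuous f}) ->
  (forall x, a <= x <= b -> `|f x - c| <= e) ->
  `|\int[mu]_(x in `[a, b]) f x - c * (b - a)| <= e * (b - a).
Proof.
move=> ab fc fe.
have mE k : \int[mu]_(x in `[a, b]) k = k * (b - a).
  rewrite Rintegral_cst//= lebesgue_measure_itv/= lte_fin.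
  (* For a = b the measure formula takes its zero branch, which agrees with b - a = 0. *)
  by move: ab; rewrite le_eqVlt => /predU1P[->|->];
    rewrite ?ltxx ?subrr// if_same.
have icst k : mu.-integrable `[a, b] (EFin \o cst k).
  by apply: continuous_itv_integrable => x _; exact: cst_continuous.
have intf := continuous_itv_integrable fc.
rewrite -!mE -RintegralB//; last exact: icst.
apply: (le_trans (le_normr_Rintegral _ _)) => //.
  exact: (integrableB _ intf (icst c)).
apply: le_Rintegral => //=.
- by apply: (integrable_norm (integrableB _ intf (icst c))).
- exact: icst.
Qed.

End interval_integral.

(** Every left endpoint lies below every right endpoint (compare both at the index [maxn n m]), so
    the supremum of the left endpoints is a common point. *)
Lemma nested_intervals (R : realType) (a b : nat -> R) :
  (forall n, a n <= a n.+1) -> (forall n, b n.+1 <= b n) ->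
  (forall n, a n <= b n) -> exists c, forall n, a n <= c <= b n.
Proof.
move=> a_incr b_decr ab.
have a_le n m : a n <= b m.
  have a_mono : {homo a : i j / (i <= j)%N >-> i <= j}.
    exact: homo_leq lexx le_trans a_incr.
  have b_mono : {homo b : i j / (i <= j)%N >-> j <= i}.
    by apply: homo_leq => [//|y x z|//]; move=> xy yz; exact: le_trans yz xy.
  apply: (le_trans (a_mono _ _ (leq_maxl n m))).
  by apply: (le_trans (ab _)); exact/b_mono/leq_maxr.
have ub m : ubound (range a) (b m) by move=> _ [n _ <-].
exists (sup (range a)) => n; apply/andP; split.
  by apply: ub_le_sup; [exists (b 0) | exists n].
by apply: ge_sup => //; exists (a 0); exists 0.
Qed.

Section green.
Variable R : realType.
Local Notation mu := (@lebesgue_measure R).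
Implicit Types (p q : R -> R -> R).

(* Closedness of p dx + q dy is the shared constant b: it is both the
   y-derivative of p and the x-derivative of q. *)
Definition closed_form_at p q x y := exists a b c, forall e : R, 0 < e ->
  exists2 d : R, 0 < d & forall u v, `|u| <= d -> `|v| <= d ->
    `|p (x + u) (y + v) - p x y - a * u - b * v| <= e * (`|u| + `|v|) /\
    `|q (x + u) (y + v) - q x y - b * u - c * v| <= e * (`|u| + `|v|).

(** The counterclockwise line integral of p dx + q dy around the rectangle. *)
Definition boundary_integral p q x0 x1 y0 y1 : R :=
  (\int[mu]_(x in `[x0, x1]) p x y0 - \int[mu]_(x in `[x0, x1]) p x y1) +
  (\int[mu]_(y in `[y0, y1]) q x1 y - \int[mu]_(y in `[y0, y1]) q x0 y).

Lemma closed_form_continuous p q x y : closed_form_at p q x y ->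
  [/\ {for x, continuous (p ^~ y)} & {for y, continuous (q x)}].
Proof.
move=> [a [b [c abc]]].
(* With error constant 1, the expansion gives |f t - f x0| <= (|k| + 1) |t - x0| near x0. *)
have gen (f : R -> R) x0 k : (forall e, 0 < e ->
    exists2 d, 0 < d & forall u, `|u| <= d ->
    `|f (x0 + u) - f x0 - k * u| <= e * `|u|) -> {for x0, continuous f}.
  move=> H; apply/cvgrPdist_le => e e0.
  have [d d0 fd] := H 1 ltr01.
  have k1 : 0 < `|k| + 1 by rewrite ltr_wpDl.
  have m0 : 0 < Num.min d (e / (`|k| + 1)) by rewrite lt_min d0 divr_gt0.
  near=> t.
  have : `|x0 - t| <= Num.min d (e / (`|k| + 1)).
    by near: t; exact: cvgr_dist_le.
  rewrite le_min distrC => /andP[td te].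
  have := fd (t - x0) td; rewrite subrKC mul1r => ft.
  rewrite distrC -[X in `|X|](subrK (k * (t - x0))).
  apply: (le_trans (ler_normD _ _)); rewrite normrM.
  move: te; rewrite ler_pdivlMr// => te.
  apply: le_trans _ te.
  by rewrite [leRHS]mulrDr mulr1 [`|k| * _]mulrC addrC lerD2l.
split.
- apply: (gen _ _ a) => e /abc[d d0 pq]; exists d => // u ud.
  have [] := pq u 0 ud; first by rewrite normr0 ltW.
  by rewrite !addr0 mulr0 subr0 normr0 addr0.
- apply: (gen _ _ c) => e /abc[d d0 pq]; exists d => // u ud.
  have [|_] := pq 0 u _ ud; first by rewrite normr0 ltW.
  by rewrite !addr0 mulr0 subr0 normr0 add0r.
Unshelve. all: by end_near. Qed.

(** The inner edges are each traversed twice, in opposite directions, and cancel. *)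
Lemma boundary_integral_split p q x0 xm x1 y0 ym y1 :
  x0 <= xm -> xm <= x1 -> y0 <= ym -> ym <= y1 ->
  (forall x y, x0 <= x <= x1 -> y0 <= y <= y1 -> closed_form_at p q x y) ->
  boundary_integral p q x0 x1 y0 y1 =
  boundary_integral p q x0 xm y0 ym + boundary_integral p q xm x1 y0 ym +
  (boundary_integral p q x0 xm ym y1 + boundary_integral p q xm x1 ym y1).
Proof.
move=> x0m xm1 y0m ym1 cl.
have pc y : y0 <= y <= y1 -> forall x, x0 <= x <= x1 ->
    {for x, continuous (p ^~ y)}.
  by move=> yy x xx; have [] := closed_form_continuous (cl x y xx yy).
have qc x : x0 <= x <= x1 -> forall y, y0 <= y <= y1 ->
    {for y, continuous (q x)}.
  by move=> xx y yy; have [] := closed_form_continuous (cl x y xx yy).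
have y01 := le_trans y0m ym1; have x01 := le_trans x0m xm1.
rewrite /boundary_integral.
rewrite (Rintegral_itv_split x0m xm1 (pc y0 _)) ?lexx//.
rewrite (Rintegral_itv_split x0m xm1 (pc y1 _)) ?lexx ?andbT//.
rewrite (Rintegral_itv_split y0m ym1 (qc x0 _)) ?lexx//.
rewrite (Rintegral_itv_split y0m ym1 (qc x1 _)) ?lexx ?andbT//.
ring.
Qed.

(** Opposite sides are compared pointwise: the affine approximations of p at heights y0 and y1
    differ by the constant b (y0 - y1), those of q at x1 and x0 by b (x1 - x0). Each comparison has
    error 2 e (s + t), integrated over a length s or t. *)
Lemma boundary_integral_small p q x y e d a b c x0 x1 y0 y1 :
  0 < e ->
  (forall u v, `|u| <= d -> `|v| <= d ->
    `|p (x + u) (y + v) - p x y - a * u - b * v| <= e * (`|u| + `|v|) /\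
    `|q (x + u) (y + v) - q x y - b * u - c * v| <= e * (`|u| + `|v|)) ->
  x0 <= x <= x1 -> y0 <= y <= y1 -> x1 - x0 <= d -> y1 - y0 <= d ->
  (forall x y, x0 <= x <= x1 -> y0 <= y <= y1 -> closed_form_at p q x y) ->
  `|boundary_integral p q x0 x1 y0 y1| <=
    2 * e * ((x1 - x0) + (y1 - y0)) ^+ 2.
Proof.
move=> e0 pq xx yy xd yd cl.
set s := x1 - x0; set t := y1 - y0.
have s0 : 0 <= s by rewrite /s; lra.
have t0 : 0 <= t by rewrite /t; lra.
have pc z : y0 <= z <= y1 -> forall w, x0 <= w <= x1 ->
    {for w, continuous (p ^~ z)}.
  by move=> zz w ww; have [] := closed_form_continuous (cl w z ww zz).
have qc w : x0 <= w <= x1 -> forall z, y0 <= z <= y1 ->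
    {for z, continuous (q w)}.
  by move=> ww z zz; have [] := closed_form_continuous (cl w z ww zz).
have y01 : y0 <= y1 by lra.
have x01 : x0 <= x1 by lra.
have pe z w : x0 <= z <= x1 -> y0 <= w <= y1 ->
    `|p z w - p x y - a * (z - x) - b * (w - y)| <= e * (s + t) /\
    `|q z w - q x y - b * (z - x) - c * (w - y)| <= e * (s + t).
  move=> zz ww.
  have zs : `|z - x| <= s by rewrite ler_norml /s; lra.
  have wt : `|w - y| <= t by rewrite ler_norml /t; lra.
  have [] := pq (z - x) (w - y) (le_trans zs xd) (le_trans wt yd).
  rewrite !subrKC => h1 h2.
  by split; [apply: le_trans h1 _|apply: le_trans h2 _];
    rewrite ler_pM2l// lerD.
have P : `|\int[mu]_(x in `[x0, x1]) (p x y0 - p x y1) - b * (y0 - y1) * s|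
    <= 2 * e * (s + t) * s.
  apply: Rintegral_itv_near_cst => // [z zz|z zz].
    by apply: cvgB; apply: pc; rewrite ?lexx ?y01.
  have [h1 _] := pe z y0 zz ltac:(by rewrite lexx y01).
  have [h2 _] := pe z y1 zz ltac:(by rewrite lexx y01).
  rewrite (_ : _ - _ = (p z y0 - p x y - a * (z - x) - b * (y0 - y)) -
    (p z y1 - p x y - a * (z - x) - b * (y1 - y))); last by ring.
  by apply: le_trans (ler_normB _ _) _; lra.
have Q : `|\int[mu]_(y in `[y0, y1]) (q x1 y - q x0 y) - b * (x1 - x0) * t|
    <= 2 * e * (s + t) * t.
  apply: Rintegral_itv_near_cst => // [z zz|z zz].
    by apply: cvgB; apply: qc; rewrite ?lexx ?x01.
  have [_ h1] := pe x0 z ltac:(by rewrite lexx x01) zz.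
  have [_ h2] := pe x1 z ltac:(by rewrite lexx x01) zz.
  rewrite (_ : _ - _ = (q x1 z - q x y - b * (x1 - x) - c * (z - y)) -
    (q x0 z - q x y - b * (x0 - x) - c * (z - y))); last by ring.
  by apply: le_trans (ler_normB _ _) _; lra.
rewrite /boundary_integral -!RintegralB//; try by
  apply: continuous_itv_integrable => z zz; (apply: pc || apply: qc);
  rewrite ?lexx ?x01 ?y01.
(* The linear parts cancel: b (y0 - y1) s + b (x1 - x0) t = 0. *)
set I := (X in `|X - _|) in P; set J := (X in `|X - _|) in Q.
have -> : I + J = (I - b * (y0 - y1) * s) + (J - b * (x1 - x0) * t).
  by rewrite /s /t; ring.
by apply: le_trans (ler_normD _ _) _; lra.
Qed.

(* Some quarter of a rectangle carries at least a fourth of its boundary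
   integral, while near a point where the form is closed the boundary integral is
   o(area). *)
Lemma closed_form_boundary_integral p q x0 x1 y0 y1 : x0 <= x1 -> y0 <= y1 ->
  (forall x y, x0 <= x <= x1 -> y0 <= y <= y1 -> closed_form_at p q x y) ->
  boundary_integral p q x0 x1 y0 y1 = 0.
Proof.
move=> x01 y01 cl; apply/eqP; rewrite -normr_le0 leNgt; apply/negP.
set eta := `|_| => eta0.
pose S n := (x1 - x0) / 2 ^+ n; pose T n := (y1 - y0) / 2 ^+ n.
have S0 n : 0 <= S n by rewrite divr_ge0 ?exprn_ge0// subr_ge0.
have T0 n : 0 <= T n by rewrite divr_ge0 ?exprn_ge0// subr_ge0.
have SS n : S n = S n.+1 + S n.+1.
  by rewrite /S exprS; field; rewrite expf_neq0.
have TS n : T n = T n.+1 + T n.+1.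
  by rewrite /T exprS; field; rewrite expf_neq0.
(* [z] is the lower left corner of an n-th generation subrectangle whose boundary integral is still
   at least eta / 4^n. *)
pose inv n (z : R * R) := [/\ x0 <= z.1, z.1 + S n <= x1, y0 <= z.2,
  z.2 + T n <= y1 & eta / 4 ^+ n <=
  `|boundary_integral p q z.1 (z.1 + S n) z.2 (z.2 + T n)|].
have step n z : inv n z -> exists w, [/\ inv n.+1 w,
    z.1 <= w.1, w.1 + S n.+1 <= z.1 + S n,
    z.2 <= w.2 & w.2 + T n.+1 <= z.2 + T n].
  case: z => x y [/= xx xS yy yT big].
  have Sn := S0 n.+1; have Tn := T0 n.+1; have Sn' := SS n; have Tn' := TS n.
  have main : exists w : R * R, ((w.1 = x) \/ (w.1 = x + S n.+1)) /\
      ((w.2 = y) \/ (w.2 = y + T n.+1)) /\ (eta / 4 ^+ n.+1 <=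
  `|boundary_integral p q w.1 (w.1 + S n.+1) w.2 (w.2 + T n.+1)|).
    (* If all four quarters were below eta / 4^(n+1), the triangle inequality would put the whole
       below eta / 4^n. *)
    apply: contrapT => nex.
    have lt4 u v : (u = x) \/ (u = x + S n.+1) ->
        (v = y) \/ (v = y + T n.+1) ->
        `|boundary_integral p q u (u + S n.+1) v (v + T n.+1)| <
        eta / 4 ^+ n.+1.
      move=> hu hv; rewrite ltNge; apply/negP => h; apply: nex.
      by exists (u, v).
    have := lt4 x y (or_introl erefl) (or_introl erefl).
    have := lt4 (x + S n.+1) y (or_intror erefl) (or_introl erefl).
    have := lt4 x (y + T n.+1) (or_introl erefl) (or_intror erefl).
    have := lt4 (x + S n.+1) (y + T n.+1) (or_intror erefl) (or_intror erefl).
    move: big; rewrite (@boundary_integral_split p q x (x + S n.+1) _ y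
      (y + T n.+1)) ?Sn' ?Tn' ?(addrA x) ?(addrA y); [|lra..|]; last first.
      by move=> u v uu vv; apply: cl; lra.
    rewrite exprS (_ : eta / (4 * 4 ^+ n) = eta / 4 ^+ n / 4); last first.
      by field; rewrite expf_neq0.
    set A := boundary_integral _ _ _ _ _ _.
    set B := boundary_integral _ _ _ _ _ _.
    set C := boundary_integral _ _ _ _ _ _.
    set D := boundary_integral _ _ _ _ _ _.
    move=> big lA lB lC lD.
    have := ler_normD (A + B) (C + D).
    have := ler_normD A B; have := ler_normD C D.
    lra.
  have [[u v] /= [hu [hv hb]]] := main; exists (u, v).
  by split=> /=; [split=> //=| | | |]; case: hu => hu; case: hv => hv; lra.
(* The choice function must be total, so outside the invariant it returns the corner unchanged. *)
have /boolp.choice[f fP] : forall nz : nat * (R * R), exists w : R * R,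
    inv nz.1 nz.2 -> [/\ inv nz.1.+1 w,
    nz.2.1 <= w.1, w.1 + S nz.1.+1 <= nz.2.1 + S nz.1,
    nz.2.2 <= w.2 & w.2 + T nz.1.+1 <= nz.2.2 + T nz.1].
  move=> -[n z] /=; have [h|h] := pselect (inv n z); last by exists z.
  by have [w wP] := step n z h; exists w.
pose z := fix z n := if n is n'.+1 then f (n', z n') else (x0, y0).
have zP n : inv n (z n).
  elim: n => [|n ih]; last by have [] := fP (n, z n) ih.
  by rewrite /inv /= /S /T expr0 !divr1 !subrKC.
have zS n : [/\ (z n).1 <= (z n.+1).1, (z n.+1).1 + S n.+1 <= (z n).1 + S n,
    (z n).2 <= (z n.+1).2 & (z n.+1).2 + T n.+1 <= (z n).2 + T n].
  by have [_ ? ? ? ?] := fP (n, z n) (zP n).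
have [cx cxP] : exists c, forall n, (z n).1 <= c <= (z n).1 + S n.
  by apply: nested_intervals => n; rewrite ?lerDl//; have [] := zS n.
have [cy cyP] : exists c, forall n, (z n).2 <= c <= (z n).2 + T n.
  by apply: nested_intervals => n; rewrite ?lerDl//; have [] := zS n.
have cx01 : x0 <= cx <= x1.
  by have := cxP 0%N; rewrite /= /S expr0 divr1 subrKC.
have cy01 : y0 <= cy <= y1.
  by have := cyP 0%N; rewrite /= /T expr0 divr1 subrKC.
have [a [b [c abc]]] := cl cx cy cx01 cy01.
pose D := (x1 - x0) + (y1 - y0).
have D0 : 0 <= D by rewrite /D; lra.
(* Chosen so that 2 e D^2 < eta; the summand 4 keeps the denominator positive when D = 0. *)
pose e := eta / (4 * D ^+ 2 + 4).
have De : 0 < 4 * D ^+ 2 + 4 by rewrite ltr_wpDl// mulr_ge0// sqr_ge0.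
have e0 : 0 < e by rewrite divr_gt0.
have [d d0 pq] := abc e e0.
(* Enough bisections to make both sides of the rectangle at most d. *)
pose n := Num.bound (D / d).
have Dn : D / 2 ^+ n <= d.
  rewrite ler_pdivrMr ?exprn_gt0// mulrC -ler_pdivrMr//.
  by apply/ltW/upper_nthrootP.
have Sd : S n <= d.
  by apply: le_trans Dn; rewrite ler_pM2r ?invr_gt0 ?exprn_gt0// /D; lra.
have Td : T n <= d.
  by apply: le_trans Dn; rewrite ler_pM2r ?invr_gt0 ?exprn_gt0// /D; lra.
have [h1 h2 h3 h4 big] := zP n.
have := boundary_integral_small e0 pq (cxP n) (cyP n).
rewrite ![_ + _ - _]addrC !addKr => /(_ Sd Td) small.
have /(le_trans big) : `|boundary_integral p q (z n).1 ((z n).1 + S n)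
    (z n).2 ((z n).2 + T n)| <= 2 * e * (S n + T n) ^+ 2.
  by apply: small => x y xx yy; apply: cl; lra.
have -> : 2 * e * (S n + T n) ^+ 2 =
    eta * (2 * D ^+ 2 / (4 * D ^+ 2 + 4)) / 4 ^+ n.
  have -> : S n + T n = D / 2 ^+ n by rewrite -mulrDl.
  rewrite expr_div_n -exprM mulnC exprM [2 ^+ 2]expr2 -natrM.
  by rewrite /e; field; rewrite expf_neq0//= gt_eqF.
(* What remains would force 4 D^2 + 4 <= 2 D^2. *)
rewrite ler_pM2r ?invr_gt0 ?exprn_gt0// ler_pMr//.
by rewrite ler_pdivlMr// mul1r; have := sqr_ge0 D; lra.
Qed.

End green.

(** * The mean value property in logarithmic polar coordinates *)

Section complex_norm.
Variable R : realType.
Implicit Types z : R[i].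

Lemma normc_norm z : `|z| = (normc z)%:C.
Proof. by []. Qed.

Lemma normc_ge0 z : 0 <= normc z.
Proof. by case: z => a b; exact: sqrtr_ge0. Qed.

Lemma ler_norm_Re z : `|Re z| <= normc z.
Proof. by have := normc_ge_Re z; rewrite normc_norm lecR. Qed.

Lemma ler_norm_Im z : `|Im z| <= normc z.
Proof.
case: z => a b /=; rewrite -sqrtr_sqr ler_wsqrtr//.
by rewrite lerDr sqr_ge0.
Qed.

Lemma normc_le_ReIm z : normc z <= `|Re z| + `|Im z|.
Proof.
rewrite {1}[z]complexE; apply: (le_trans (le_normcD _ _)).
by rewrite normcM /= !expr0n/= expr1n !(addr0, add0r) sqrtr1 mul1r !sqrtr_sqr.
Qed.

End complex_norm.

Section first_order_expansion.

(** Stated over any numeric field so as to serve both R and R[i]. The limit defining the derivative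
    concerns h != 0 only; at h = 0 both sides vanish. *)
Lemma derivable_expansion (K : numFieldType) (f : K^o -> K^o) (x : K^o)
    (e : K) :
  derivable f x 1 -> 0 < e ->
  exists2 d : K, 0 < d & forall h, `|h| < d ->
    `|f (x + h) - f x - 'D_1 f x * h| <= e * `|h|.
Proof.
move=> fD e0.
have := (@cvgrPdist_le _ _ _ _ (dnbhs_filter _) _ _).1 fD e e0.
rewrite near_withinE => /nbhs_normP[d /= d0 fd]; exists d => // h hd.
have [->|h0] := eqVneq h 0.
  by rewrite addr0 subrr mulr0 subr0 normr0 mulr0.
have /fd/(_ h0) : ball_ Num.norm 0 d h by rewrite /= sub0r normrN.
rewrite /= distrC [h *: _]mulr1 [h + x]addrC => le_e.
have -> : f (x + h) - f x - 'D_1 f x * h =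
    (h^-1 *: (f (x + h) - f x) - 'D_1 f x) * h.
  by rewrite mulrBl [_ *: _]mulrC mulfVK.
by rewrite normrM ler_wpM2r.
Qed.

Variable R : realType.

Lemma is_derive_expansion (f : R -> R) (x df e : R) :
  is_derive x 1 f df -> 0 < e ->
  exists2 d : R, 0 < d & forall h, `|h| < d ->
    `|f (x + h) - f x - df * h| <= e * `|h|.
Proof. by move=> [fx <-]; exact: derivable_expansion. Qed.

Lemma complex_derivable_expansion (f : R[i] -> R[i]) (x : R[i]) :
  derivable (f : R[i]^o -> R[i]^o) x 1 ->
  exists D : R[i], forall e : R, 0 < e ->
  exists2 d : R, 0 < d & forall h, normc h < d ->
    normc (f (x + h) - f x - D * h) <= e * normc h.
Proof.
move=> fx; exists ('D_1 (f : R[i]^o -> R[i]^o) x) => e e0.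
have eC : 0 < e%:C by rewrite ltcR.
(* A positive element of R[i] is real, so this radius comes from R. *)
have [[d d'] /=] := derivable_expansion fx eC.
rewrite ltcE /= => /andP[/eqP -> d0] fd; exists d => // h hd.
by rewrite -lecR rmorphM/=; apply: fd; rewrite normc_norm ltcR.
Qed.

End first_order_expansion.

Section log_polar.
Variable R : realType.

(** The complex exponential exp (t + i s) in real coordinates. *)
Definition log_polar (t s : R) : R[i] := (expR t * cos s) +i* (expR t * sin s).

Lemma normc_log_polar t s : normc (log_polar t s) = expR t.
Proof.
by rewrite /= !exprMn -mulrDr cos2Dsin2 mulr1 sqrtr_sqr ger0_norm ?expR_ge0.
Qed.

Lemma log_polarD t u s v :
  log_polar (t + u) (s + v) = log_polar t s * log_polar u v.
Proof. by rewrite /log_polar expRD cosD sinD; simpc; congr (_ +i* _); ring. Qed.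

(** Multiplicativity ([log_polarD]) moves the expansion to 0, where it follows from those of exp,
    cos and sin. *)
Lemma log_polar_expansion t s (e : R) : 0 < e ->
  exists2 d : R, 0 < d & forall u v, `|u| < d -> `|v| < d ->
  normc (log_polar (t + u) (s + v) - log_polar t s - log_polar t s * (u +i* v))
    <= e * (`|u| + `|v|).
Proof.
move=> e0.
(* Each coordinate will have error 3 e1, and the factor [log_polar t s] has modulus [expR t]; hence
   8 [expR t] suffices. *)
pose e1 := Num.min 1 (e / (8 * expR t)).
have te0 : 0 < 8 * expR t by rewrite mulr_gt0 ?expR_gt0.
have e10 : 0 < e1 by rewrite lt_min ltr01 divr_gt0.
have [d1 d10 he] := is_derive_expansion (is_derive_expR (0 : R)) e10.
have [d2 d20 hc] := is_derive_expansion (is_derive_cos (0 : R)) e10.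
have [d3 d30 hs] := is_derive_expansion (is_derive_sin (0 : R)) e10.
(* The bound |u| < e1 / 2 yields |exp u - 1| <= 2 |u| <= e1. *)
exists (Num.min (Num.min d1 d2) (Num.min d3 (e1 / 2))).
  by rewrite !lt_min d10 d20 d30 divr_gt0.
move=> u v; rewrite !lt_min => /andP[/andP[u1 _] /andP[_ ue]].
move=> /andP[/andP[_ v2] /andP[v3 _]].
have := he u u1; have := hc v v2; have := hs v v3.
rewrite !add0r expR0 cos0 sin0 oppr0 mul0r !mul1r subr0 addr0.
set E := expR u; set C := cos v; set S := sin v => Hs Hc He.
have e11 : e1 <= 1 by rewrite ge_min lexx.
have E1 : `|E - 1| <= e1.
  apply: le_trans (_ : `|E - 1 - u| + `|u| <= _).
    by rewrite -{1}[E - 1](subrK u); exact: ler_normD.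
  by nra.
have E2 : `|E| <= 2.
  have := ler_normD (E - 1) 1; rewrite subrK normr1; lra.
rewrite log_polarD (_ : _ - _ =
  log_polar t s * (log_polar u v - 1 - (u +i* v))); last by ring.
rewrite normcM normc_log_polar mulrC -ler_pdivlMr ?expR_gt0//.
apply: le_trans (normc_le_ReIm _) _; rewrite /= -/E -/C -/S oppr0 addr0.
have h1 : `|E * C - 1 - u| <= 3 * e1 * (`|u| + `|v|).
  have -> : E * C - 1 - u = (E - 1 - u) + E * (C - 1) by ring.
  have := ler_normD (E - 1 - u) (E * (C - 1)); rewrite normrM.
  have := ler_pM (normr_ge0 _) (normr_ge0 _) E2 Hc.
  have := mulr_ge0 (ltW e10) (normr_ge0 u).
  have := mulr_ge0 (ltW e10) (normr_ge0 v).
  lra.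
have h2 : `|E * S - v| <= 3 * e1 * (`|u| + `|v|).
  have -> : E * S - v = (E - 1) * v + E * (S - v) by ring.
  have := ler_normD ((E - 1) * v) (E * (S - v)); rewrite !normrM.
  have := ler_pM (normr_ge0 _) (normr_ge0 _) E2 Hs.
  have := ler_wpM2r (normr_ge0 v) E1.
  have := mulr_ge0 (ltW e10) (normr_ge0 u); lra.
apply: le_trans (lerD h1 h2) _.
rewrite (_ : e * _ / _ = 8 * (e / (8 * expR t)) * (`|u| + `|v|)); last first.
  by field; rewrite gt_eqF ?expR_gt0.
have e1e : e1 <= e / (8 * expR t) by rewrite ge_min lexx orbT.
have uv0 : 0 <= `|u| + `|v| by rewrite addr_ge0.
have := ler_wpM2r uv0 e1e; have := mulr_ge0 (ltW e10) uv0; lra.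
Qed.

(* d z / (i z) = d s - i d t, so the form below is Re (f d z / (i z)). *)
Lemma closed_form_log_polar (f : R[i] -> R[i]) t s :
  derivable (f : R[i]^o -> R[i]^o) (log_polar t s) 1 ->
  closed_form_at (fun t s => Im (f (log_polar t s)))
    (fun t s => Re (f (log_polar t s))) t s.
Proof.
move=> /complex_derivable_expansion[D fD].
set z := log_polar t s in fD *.
have main (e : R) : 0 < e -> exists2 d : R, 0 < d & forall u v,
    `|u| <= d -> `|v| <= d ->
    normc (f (log_polar (t + u) (s + v)) - f z - D * z * (u +i* v)) <=
    e * (`|u| + `|v|).
  move=> e0.
  (* [L] is a local Lipschitz constant of [log_polar] at (t, s). *)
  pose L := expR t + 1.
  have L0 : 0 < L by rewrite addr_gt0 ?expR_gt0.
  have N0 : 0 < normc D + 1 by rewrite ltr_wpDl ?normc_ge0.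
  have [d d0 hd] := fD (e / (2 * L)) (divr_gt0 e0 (mulr_gt0 (ltr0Sn _ 1) L0)).
  have [d' d'0 hd'] := @log_polar_expansion t s
    (Num.min 1 (e / (2 * (normc D + 1))))
    ltac:(by rewrite lt_min ltr01 divr_gt0 ?mulr_gt0).
  set m := Num.min 1 _ in hd'.
  exists (Num.min (d' / 2) (d / (4 * L))).
    by rewrite lt_min !divr_gt0 ?mulr_gt0.
  move=> u v; rewrite !le_min => /andP[ud' ud] /andP[vd' vd].
  have {}hd' := hd' u v ltac:(lra) ltac:(lra).
  set w := u +i* v in hd' *.
  have wuv : normc w <= `|u| + `|v| by exact: normc_le_ReIm.
  set h := log_polar (t + u) (s + v) - z in hd'.
  have uv0 : 0 <= `|u| + `|v| by rewrite addr_ge0.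
  have m1 : m <= 1 by rewrite ge_min lexx.
  have hle : normc h <= L * (`|u| + `|v|).
    rewrite -[h](subrK (z * w)); apply: le_trans (le_normcD _ _) _.
    rewrite normcM normc_log_polar /L mulrDl mul1r addrC lerD//.
      by rewrite ler_wpM2l ?expR_ge0.
    by apply: le_trans hd' _; rewrite ler_piMl.
  have hlt : normc h < d.
    apply: le_lt_trans hle _; rewrite mulrC -ltr_pdivlMr//.
    have : 0 < d / L by rewrite divr_gt0.
    have -> : d / L = 4 * (d / (4 * L)) by field; rewrite gt_eqF.
    lra.
  have {}hd := hd h hlt.
  have -> : log_polar (t + u) (s + v) = z + h by rewrite /h subrKC.
  (* Chain rule: the error of f at increment h, plus D times the error of [log_polar]; each is
     allotted e / 2. *)
  have -> : f (z + h) - f z - D * z * w =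
    (f (z + h) - f z - D * h) + D * (h - z * w) by ring.
  apply: le_trans (le_normcD _ _) _; rewrite normcM.
  have h1 : e / (2 * L) * normc h <= e / 2 * (`|u| + `|v|).
    have -> : e / 2 * (`|u| + `|v|) = e / (2 * L) * (L * (`|u| + `|v|)).
      by field; rewrite gt_eqF.
    by rewrite ler_pM2l// divr_gt0// mulr_gt0.
  have h2 : normc D * normc (h - z * w) <= e / 2 * (`|u| + `|v|).
    have mD : (normc D + 1) * m <= e / 2.
      rewrite mulrC -ler_pdivlMr// (_ : e / 2 / _ = e / (2 * (normc D + 1))).
        by rewrite ge_min lexx orbT.
      by field; rewrite gt_eqF.
    have DD : normc D <= normc D + 1 by rewrite lerDl.
    apply: le_trans (ler_pM (normc_ge0 _) (normc_ge0 _) DD hd') _.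
    by rewrite mulrA ler_wpM2r.
  by apply: le_trans (lerD hd (lexx _)) _; lra.
(* These are the Cauchy-Riemann equations: with D z = alpha + i beta, the product D z (u + i v) has
   imaginary part beta u + alpha v and real part alpha u - beta v, and alpha is the shared
   coefficient. *)
exists (Im (D * z)), (Re (D * z)), (- Im (D * z)) => e /main[d d0 hd].
exists d => // u v ud vd; have {}hd := hd u v ud vd.
split.
  apply: le_trans (le_trans (ler_norm_Im _) hd).
  by rewrite -/z; case: (f z) (f _) (D * z) => ? ? [? ?] [? ?] /=;
    rewrite le_eqVlt; apply/orP; left; apply/eqP; congr `|_|; ring.
apply: le_trans (le_trans (ler_norm_Re _) hd).
by rewrite -/z; case: (f z) (f _) (D * z) => ? ? [? ?] [? ?] /=;
  rewrite le_eqVlt; apply/orP; left; apply/eqP; congr `|_|; ring.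
Qed.

End log_polar.

Lemma log_polar_2pi (R : realType) (t : R) :
  log_polar t (2 * pi) = log_polar t 0.
Proof. by rewrite /log_polar mulr_natl cos2pi sin2pi cos0 sin0. Qed.

Section mean_value.
Variable R : realType.
Local Notation mu := (@lebesgue_measure R).
Variable f : R[i] -> R[i].
Hypothesis f_derivable : forall z, `|z| < 1 ->
  derivable (f : R[i]^o -> R[i]^o) z 1.

Let polar_form t s : t < 0 ->
  closed_form_at (fun t s => Im (f (log_polar t s)))
    (fun t s => Re (f (log_polar t s))) t s.
Proof.
move=> t0; apply: closed_form_log_polar; apply: f_derivable.
by rewrite normc_norm normc_log_polar ltcR expR_lt1.
Qed.

(** On the rectangle [a, b] x [0, 2 pi] the sides s = 0 and s = 2 pi cancel by periodicity; the
    other two sides are the circles of radii e^a and e^b. *)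
Lemma circle_mean_const a b : a <= b -> b < 0 ->
  \int[mu]_(s in `[0, 2 * pi]) Re (f (log_polar a s)) =
  \int[mu]_(s in `[0, 2 * pi]) Re (f (log_polar b s)).
Proof.
move=> ab b0.
have pi2 : 0 <= 2 * pi :> R by rewrite mulr_ge0 ?pi_ge0.
have cl t s : a <= t <= b -> 0 <= s <= 2 * pi ->
    closed_form_at (fun t s => Im (f (log_polar t s)))
      (fun t s => Re (f (log_polar t s))) t s.
  by move=> /andP[_ tb] _; apply: polar_form; exact: le_lt_trans tb b0.
have := closed_form_boundary_integral ab pi2 cl.
rewrite /boundary_integral.
under [X in _ - X + _]eq_Rintegral do rewrite log_polar_2pi.
by rewrite subrr add0r => /eqP; rewrite subr_eq0 => /eqP ->.
Qed.

(** The integral does not depend on the radius, so it is evaluated on a circle small enough for f to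
    be close to f 0. *)
Lemma circle_mean t : t < 0 ->
  \int[mu]_(s in `[0, 2 * pi]) Re (f (log_polar t s)) = Re (f 0) * (2 * pi).
Proof.
move=> t0; have pi2 : 0 < 2 * pi :> R by rewrite mulr_gt0 ?pi_gt0.
apply/eqP; rewrite -subr_eq0 -normr_le0.
apply/ler_addgt0Pl => e e0; rewrite addr0.
have [D fD] := complex_derivable_expansion (f_derivable (z := 0)
  ltac:(by rewrite normr0 ltr01)).
have [d d0 hd] := fD 1 ltr01.
have N0 : 0 < normc D + 1 by rewrite ltr_wpDl ?normc_ge0.
(* A radius within reach of the expansion at 0, with (|D| + 1) m <= e / (2 pi). *)
pose m := Num.min (d / 2) (e / (2 * pi) / (normc D + 1)).
have m0 : 0 < m by rewrite lt_min !divr_gt0.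
pose a := Num.min t (ln m).
have at_ : a <= t by rewrite ge_min lexx.
have a0 : a < 0 := le_lt_trans at_ t0.
rewrite -(circle_mean_const at_ t0).
have -> : e = e / (2 * pi) * (2 * pi - 0) by rewrite subr0 divfK ?gt_eqF.
rewrite -{2}[2 * pi]subr0; apply: (Rintegral_itv_near_cst (ltW pi2)) => s _.
  by have [] := closed_form_continuous (polar_form s a0).
set z := log_polar a s.
have zm : normc z <= m.
  by rewrite normc_log_polar -[leRHS]lnK// ler_expR ge_min lexx orbT.
have zd : normc z < d.
  by apply: le_lt_trans zm _; rewrite gt_min; apply/orP; left; lra.
have := hd z zd; rewrite add0r mul1r => h.
rewrite -raddfB /=; apply: le_trans (ler_norm_Re _) _.
rewrite -[_ - _](subrK (D * z)); apply: le_trans (le_normcD _ _) _.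
rewrite normcM; apply: (@le_trans _ _ ((normc D + 1) * normc z)).
  by rewrite mulrDl mul1r addrC lerD2l.
rewrite mulrC -ler_pdivlMr//; apply: le_trans zm _.
by rewrite ge_min lexx orbT.
Qed.

End mean_value.

(** * Measure theory on the circle *)

Section circle.
Variable R : realType.
Local Notation mu := (@lebesgue_measure R).

Lemma complex_lipschitz_continuous (V : normedModType R) (g : R[i]^o -> V) :
  (forall z w, `|g z - g w| <= normc (z - w)) -> continuous g.
Proof.
move=> gL z; apply/(@cvgrPdist_lt _ _ _ _ (nbhs_filter (z : R[i]^o))) => e e0.
apply/(@nbhs_normP _ (R[i]^o)).
exists e%:C; rewrite /= ?ltcR// => w /=.
rewrite normc_norm ltcR; exact: le_lt_trans.
Qed.

Lemma continuous_Re : continuous (fun z : R[i]^o => Re z).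
Proof.
apply: (@complex_lipschitz_continuous R^o) => z w /=.
by rewrite -raddfB; exact: ler_norm_Re.
Qed.

Lemma continuous_conjc : continuous (fun z : R[i]^o => conjc z : R[i]^o).
Proof.
move=> z; apply/(@cvgrPdist_lt _ _ _ _ (nbhs_filter (z : R[i]^o))) => e e0.
apply/(@nbhs_normP _ (R[i]^o)); exists e => // w /=.
by rewrite -rmorphB normcJ.
Qed.

Lemma lebesgue_measure_reflect (c : R) (A : set R) : measurable A ->
  pushforward mu (fun x => c - x : measurableTypeR R) A = mu A.
Proof.
move=> mA.
have mc : measurable_fun setT
    (fun x : measurableTypeR R => c - x : measurableTypeR R).
  by apply: measurable_funB => //; exact: measurable_cst.
apply/esym/lebesgue_measure_unique => //= _ [[a b]] _ <-.
rewrite /pushforward (_ : _ @^-1` _ = `[c - b, c - a[%classic).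
  rewrite !lebesgue_measure_itv/= !lte_fin ltrD2l ltrN2.
  by congr (if _ then _ else _); rewrite -!EFinB; congr _%:E; ring.
by apply/seteqP; split=> x /=; rewrite !in_itv/= => /andP[? ?]; lra.
Qed.

Lemma measurable_circle_open (U : set R[i]^o) : open U ->
  measurable (val @^-1` U : set (circle R)).
Proof. by move=> oU; apply: sub_sigma_algebra; exists U. Qed.

(** Continuity is assumed at points of the circle only, so the preimage of an open interval may fail
    to be open in R[i]; its interior has the same trace on the circle. *)
Lemma measurable_circle_continuous (h : R[i]^o -> R) :
  (forall z : circle R, {for val z, continuous h}) ->
  measurable_fun setT (fun z : circle R => h (val z)).
Proof.
move=> ch; apply: (measurability _ (RGenOpens.measurableE R)).
move=> _ [_ [x [y ->]] <-]; rewrite setTI.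
have oxy : open `]x, y[%classic by exact: interval_open.
rewrite (_ : _ @^-1` _ =
    val @^-1` (interior (h @^-1` `]x, y[%classic) : set R[i]^o)).
  by apply: measurable_circle_open; exact: open_interior.
apply/seteqP; split=> z /= hz; last exact: interior_subset hz.
by apply: ch; exact: open_nbhs_nbhs.
Qed.

Lemma measurable_conj_circle : measurable_fun setT (@conj_circle R).
Proof.
have mE : @measurable _ (circle R) = <<s @circle_open R >> by [].
refine (@measurability _ _ _ (circle R) setT (@conj_circle R)
  (@circle_open R) mE _).
move=> _ [_ [U oU <-] <-]; rewrite setTI.
have oC : open ((fun z : R[i]^o => conjc z : R[i]^o) @^-1` U).
  by move/continuousP : continuous_conjc; exact.
exact: (measurable_circle_open oC).
Qed.

Lemma ge0_integral_circle (G : circle R -> \bar R) :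
  measurable_fun setT G -> (forall z, (0 <= G z)%E) ->
  (\int[circle_prob R]_z G z =
   (2 * pi)^-1%:E * \int[mu]_(t in `[0%R, (2 * pi)%R]) G (expi t))%E.
Proof.
move=> mG G0; rewrite ge0_integral_distribution// integral_uniform ?subr0//.
- exact: measurableT_comp mG (@measurable_expi R).
- by move=> t; exact: G0.
Qed.

(** In the angle, conjugation is t |-> 2 pi - t, which maps [0, 2 pi] onto itself and preserves
    Lebesgue measure. *)
Lemma measure_preserving_conj_circle : measure_preserving (@conj_circle R).
Proof.
split=> [|A mA]; first exact: measurable_conj_circle.
have mcA : measurable (@conj_circle R @^-1` A).
  by rewrite -[_ @^-1` _]setTI; exact: measurable_conj_circle.
have cE (B : set (circle R)) : measurable B -> circle_prob R B =
    ((2 * pi)^-1%:E * \int[mu]_(t in `[0%R, (2 * pi)%R]) (\1_B (expi t))%:E)%E.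
  move=> mB.
  have mI : measurable_fun setT (fun z : circle R => (\1_B z : R)%:E).
    exact/measurable_EFinP/measurable_indic.
  have I0 (z : circle R) : (0 <= (\1_B z : R)%:E)%E by rewrite lee_fin.
  by rewrite -(ge0_integral_circle mI I0) integral_indic// setIT.
rewrite !cE//; congr (_ * _)%E.
pose B := @expi_circle R @^-1` A.
have mB : measurable B by rewrite -[B]setTI; exact: measurable_expi.
have mB' : measurable (@expi_circle R @^-1` (@conj_circle R @^-1` A)).
  by rewrite -[X in measurable X]setTI; exact: measurable_expi.
rewrite (eq_integral (fun t =>
  (\1_(@expi_circle R @^-1` (@conj_circle R @^-1` A)) t)%:E))//.
rewrite [RHS](eq_integral (fun t => (\1_B t)%:E))//.
rewrite !integral_indic//= -/B.
rewrite -[RHS](lebesgue_measure_reflect (2 * pi)); last exact: measurableI.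
have conjE t :
    conj_circle (expi_circle t) = expi_circle (2 * pi - t) :> circle R.
  apply: val_inj => /=; rewrite mulr_natl cosB sinB cos2pi sin2pi.
  by congr (_ +i* _); ring.
congr (mu _); apply/seteqP; split=> t /=; rewrite conjE !in_itv/= => -[Bt tpi];
  by split=> //; lra.
Qed.

(* Fatou's lemma is applied to K - Re f on the circles of radius
   1 - 1/(n+2). *)
Lemma radial_limit_bound (f : R[i] -> R[i]) (K y : R) :
  (forall z, `|z| < 1 -> derivable (f : R[i]^o -> R[i]^o) z 1) ->
  (forall z, `|z| < 1 -> Re (f z) <= K) ->
  {ae circle_prob R, forall g : circle R, exists2 l : R[i], Re l <= y &
     (f (t%:C * val g) : R[i]^o) @[t --> (1 : R)^'-] --> (l : R[i]^o)} ->
  Re (f 0) <= y.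
Proof.
move=> fD fK fl.
(* The shift by 2 makes [rho 0] positive, so that [ln (rho n)] is the logarithmic radius for every
   n. *)
pose rho n : R := 1 - n.+2%:R^-1.
have rho01 n : 0 < rho n < 1.
  by rewrite /rho subr_gt0 invf_lt1 ?ltr1n ?ltr0n// gtrBl invr_gt0 ltr0n.
pose w n (g : circle R) := K - Re (f ((rho n)%:C * val g)).
have rn n (g : circle R) : `|(rho n)%:C * val g| < 1.
  rewrite normrM (eqP (valP g)) mulr1 normc_norm ltcR /= expr0n addr0 sqrtr_sqr.
  by have := rho01 n => /andP[? ?]; rewrite gtr0_norm.
have mw n : measurable_fun setT (fun g => (w n g)%:E).
  apply/measurable_EFinP; apply: measurable_funB => //.
  apply: (@measurable_circle_continuous
    (fun z => Re (f ((rho n)%:C * z)))) => g.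
  have c1 : {for val g, continuous (fun z : R[i]^o => (rho n)%:C * z : R[i]^o)}.
    exact: mulrl_continuous.
  have c2 : {for (rho n)%:C * val g, continuous (f : R[i]^o -> R[i]^o)}.
    by apply/differentiable_continuous/derivable1_diffP/fD; exact: rn.
  exact: (continuous_comp (continuous_comp c1 c2) (@continuous_Re _)).
have w0 n g : (0 <= (w n g)%:E)%E by rewrite lee_fin subr_ge0 fK.
have Iw n : (\int[circle_prob R]_g (w n g)%:E = (K - Re (f 0))%:E)%E.
  rewrite (ge0_integral_circle (mw n) (w0 n)).
  have [r0 r1] := andP (rho01 n).
  have pi2 : 0 < 2 * pi :> R by rewrite mulr_gt0 ?pi_gt0.
  have lr0 : ln (rho n) < 0 by rewrite ln_lt0// r0.
  have wE t : w n (expi t) = K - Re (f (log_polar (ln (rho n)) t)).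
    by rewrite /w /log_polar lnK//; congr (K - Re (f _)); simpc.
  under eq_integral do rewrite wE.
  have fint : mu.-integrable `[0, 2 * pi]
      (EFin \o (fun t => Re (f (log_polar (ln (rho n)) t)))).
    apply: continuous_itv_integrable => t _.
    have [] // := closed_form_continuous (closed_form_log_polar
      (f := f) (t := ln (rho n)) (s := t) _).
    by apply: fD; rewrite normc_norm normc_log_polar ltcR expR_lt1.
  have cint : mu.-integrable `[0, 2 * pi] (EFin \o cst K).
    by apply: continuous_itv_integrable => t _; exact: cst_continuous.
  rewrite -[X in (_ * X)%E]fineK; last first.
    exact: integrable_fin_num (integrableB _ cint fint).
  rewrite -EFinM; congr EFin.
  rewrite -/(Rintegral _ _ _) RintegralB// circle_mean// Rintegral_cst//.
  rewrite /= lebesgue_measure_itv/= lte_fin pi2 /= subr0.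
  by rewrite -mulrBl mulrCA mulVf ?mulr1 ?gt_eqF.
(* If K <= y the bound on f at 0 is enough; otherwise the constant K - y is nonnegative, as the
   comparison of integrals below requires. *)
have [|yK] := leP K y.
  by apply: le_trans; apply: fK; rewrite normr0 ltr01.
pose v (g : circle R) := limn_einf (fun n => (w n g)%:E).
have L : limn_einf (fun n => \int[circle_prob R]_g (w n g)%:E)%E =
    (K - Re (f 0))%:E.
  rewrite (_ : (fun n => _) = (fun=> (K - Re (f 0))%:E)).
    by have [] := cvg_limn_einf_sup (cvg_cst (K - Re (f 0))%:E).
  by apply/funext => n; exact: Iw.
have mv : measurable_fun setT v.
  apply: measurableT_comp => //.
  apply: (measurable_fun_limn_esup (f := fun n g => (- (w n g)%:E)%E)) => n.
  exact: measurableT_comp.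
have v0 g : (0 <= v g)%E.
  rewrite /v limn_einf_lim; apply: lime_ge; first exact: is_cvg_einfs.
  by apply: nearW => n; apply: le_ereal_inf_tmp => _ [k _ <-].
have cv : {ae circle_prob R, forall g, setT g -> ((K - y)%:E <= v g)%E}.
  apply: filterS fl => g [l ly fgl] _.
  suff wl : (w n g)%:E @[n --> \oo] --> (K - Re l)%:E.
    by rewrite /v (cvg_limn_einf_sup wl).1 lee_fin lerB.
  apply: cvg_EFin; first exact: nearW.
  apply: cvgB; first exact: cvg_cst.
  have rho1 : rho n @[n --> \oo] --> (1 : R)^'-.
    move=> A [e /= e0 eA].
    suff : \forall n \near \oo, A (rho n) by []; near=> n.
    have [r0 r1] := andP (rho01 n).
    apply: eA => //=; rewrite /rho opprB addrC subrK ger0_norm ?invr_ge0//.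
    apply: (@lt_trans _ _ n.+1%:R^-1).
      by rewrite ltf_pV2 ?posrE ?ltr0n// ltr_nat.
    by near: n; exact: (near_infty_natSinv_lt (PosNum e0)).
  have := cvg_comp _ _ rho1 fgl.
  move=> h; exact: (continuous_cvg _ (@continuous_Re l) h).
(* The chain is K - y <= integral of v <= liminf of the integrals of [w n] = K - Re (f 0). *)
rewrite -lerN2 -(lerD2l K) -lee_fin -L.
apply: le_trans (fatou (circle_prob R) measurableT mw (fun n g _ => w0 n g)).
have -> : (K - y)%:E = (\int[circle_prob R]_(g in setT) (cst (K - y)%:E g))%E.
  rewrite integral_cst//.
  by rewrite [X in (_ * X)%E](@probability_setT _ _ _ (circle_prob R)) mule1.
apply: ae_ge0_le_integral => //.
- by move=> g _; rewrite lee_fin subr_ge0 ltW.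
- by move=> g _; exact: v0.
Unshelve. all: by end_near. Qed.

End circle.

(** * The square root of W and its analytic factorization *)

Section square_root_weight.
Variable R : realType.

Lemma sqr_normc_ReIm (z : R[i]) : normc z ^+ 2 = Re z ^+ 2 + Im z ^+ 2.
Proof. by case: z => a b /=; rewrite sqr_sqrtr// addr_ge0 ?sqr_ge0. Qed.

Lemma complex_ext (z w : R[i]) : Re z = Re w -> Im z = Im w -> z = w.
Proof. by case: z w => a b [c e] /= -> ->. Qed.

Lemma I2_cases (i : 'I_2) : i = 0 \/ i = 1.
Proof. by case: i => -[|[|//]] h; [left|right]; exact: val_inj. Qed.

Lemma numconj_conjc (z : R[i]) : Num.conj z = conjc z.
Proof. by []. Qed.

Lemma norm2_form N (x : 'cV[R[i]]_N) : (norm2 x ^+ 2)%:C = (x ^t* *m x) 0 0.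
Proof.
rewrite /norm2 sqr_sqrtr ?sumr_ge0// => [|i _]; last exact: sqr_ge0.
rewrite rmorph_sum mxE; apply: eq_bigr => i _; rewrite !mxE numconj_conjc.
by rewrite mulrC -sqr_normc normc_norm rmorphXn.
Qed.

(** A hermitian B with B B = A satisfies |B x|^2 = x^* B B x = x^* A x; the hypothesis excludes the
    default value of [xget]. *)
Lemma ell2_sqrtmx N (A : 'M[R[i]]_N) x : (exists B, psdmx B /\ B *m B = A) ->
  (ell2 (sqrtmx A) x ^+ 2)%:C = (x ^t* *m A *m x) 0 0.
Proof.
move=> exB; rewrite /ell2 norm2_form.
have [[herm _] BB] : psdmx (sqrtmx A) /\ sqrtmx A *m sqrtmx A = A.
  by rewrite /sqrtmx; case: xgetP => [B _ //|/(_ _)]; case: exB => B hB /(_ B).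
have hB : (sqrtmx A) ^t* = sqrtmx A.
  by move/is_hermitianmxP : herm; rewrite expr0 scale1r.
by rewrite trmx_mul map_mxM hB -[in RHS]BB !mulmxA.
Qed.

(** The hermitian form of W at the vector (u, v), with g any complex number so that continuity in g
    makes sense. *)
Definition Wform (r : R) (g u v : R[i]) : R :=
  Num.sqrt (1 + r ^+ 2) * (normc u ^+ 2 + normc v ^+ 2) +
  2 * r * Re (g * v * conjc u).

Lemma form_entries2 (A : 'M[R[i]]_2) (x : 'cV[R[i]]_2) :
  (x ^t* *m A *m x) 0 0 =
  conjc (x 0 0) * A 0 0 * x 0 0 + conjc (x 1 0) * A 1 0 * x 0 0 +
  (conjc (x 0 0) * A 0 1 * x 1 0 + conjc (x 1 0) * A 1 1 * x 1 0).
Proof.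
rewrite !mxE !big_ord_recl !big_ord0 !mxE !big_ord_recl !big_ord0 !mxE.
rewrite !numconj_conjc.
rewrite (_ : lift ord0 ord0 = 1); last exact/val_inj.
by rewrite !addr0 !mulrDl.
Qed.

Lemma W_entries r (g : circle R) : [/\ W r g 0 0 = (Num.sqrt (1 + r ^+ 2))%:C,
  W r g 0 1 = r%:C * val g, W r g 1 0 = r%:C * conjc (val g) &
  W r g 1 1 = (Num.sqrt (1 + r ^+ 2))%:C].
Proof. by split; rewrite mxE. Qed.

Lemma form_W r (g : circle R) (x : 'cV[R[i]]_2) :
  (x ^t* *m W r g *m x) 0 0 = (Wform r (val g) (x 0 0) (x 1 0))%:C.
Proof.
rewrite form_entries2; have [-> -> -> ->] := W_entries r g.
rewrite /Wform !sqr_normc_ReIm; move: (Num.sqrt _) => d.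
case: (x 0 0) (x 1 0) (val g) => a b [c e] [p q].
by apply: complex_ext; simpc => /=; ring.
Qed.

Lemma unit_circle_sqr (g : circle R) : Re (val g) ^+ 2 + Im (val g) ^+ 2 = 1.
Proof.
by apply: complexI; rewrite add_Re2_Im2 (eqP (valP g)) expr1n.
Qed.

Lemma cross_term_bound (g : circle R) (u v : R[i]) :
  `|2 * Re (val g * v * conjc u)| <= normc u ^+ 2 + normc v ^+ 2.
Proof.
have := unit_circle_sqr g; rewrite !sqr_normc_ReIm.
case: (val g) u v => p q [a b] [c e] /= pq.
have h : (p * c - q * e) ^+ 2 + (p * e + q * c) ^+ 2 = c ^+ 2 + e ^+ 2.
  by rewrite -[RHS]mul1r -pq; ring.
rewrite -h ler_norml.
have := sqr_ge0 (p * c - q * e - a); have := sqr_ge0 (p * c - q * e + a).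
have := sqr_ge0 (p * e + q * c - b); have := sqr_ge0 (p * e + q * c + b).
by move=> ? ? ? ?; apply/andP; split; nra.
Qed.

(** The constants d - r and d + r are the eigenvalues of W. *)
Lemma Wform_bounds r (g : circle R) (u v : R[i]) : 0 < r ->
  (Num.sqrt (1 + r ^+ 2) - r) * (normc u ^+ 2 + normc v ^+ 2) <=
  Wform r (val g) u v <=
  (Num.sqrt (1 + r ^+ 2) + r) * (normc u ^+ 2 + normc v ^+ 2).
Proof.
set d := Num.sqrt _ => r0.
have := cross_term_bound g u v; rewrite ler_norml /Wform -/d.
by set N := _ + _; set X := Re _ => /andP[? ?]; apply/andP; split; nra.
Qed.

Lemma sqrt1Dsqr_gt r : r < Num.sqrt (1 + r ^+ 2) :> R.
Proof.
apply: le_lt_trans (ler_norm r) _.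
by rewrite -sqrtr_sqr ltr_sqrt ?ltrDr// ltr_pwDl// sqr_ge0.
Qed.

(* Cayley-Hamilton: det W = 1 and tr W = 2 d, so (W + 1)^2 = (2 d + 2) W. *)
Lemma W_sqrtmx_exists r (g : circle R) : 0 < r ->
  exists B, psdmx B /\ B *m B = W r g.
Proof.
move=> r0; pose d := Num.sqrt (1 + r ^+ 2).
have rd : r < d := sqrt1Dsqr_gt r.
pose s := (Num.sqrt (2 * d + 2))^-1.
have d2 : 0 < 2 * d + 2 by lra.
have s0 : 0 <= s by rewrite invr_ge0 sqrtr_ge0.
have s2 : s ^+ 2 * (2 * d + 2) = 1.
  by rewrite exprVn sqr_sqrtr ?(ltW d2)// mulVf ?gt_eqF.
have dd : d ^+ 2 = 1 + r ^+ 2 by rewrite sqr_sqrtr// addr_ge0 ?sqr_ge0.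
exists (s%:C *: (W r g + 1)); split; [split|].
- apply/is_hermitianmxP; rewrite expr0 scale1r; apply/matrixP => i j.
  rewrite !mxE numconj_conjc -/d; case: (val g) => p q.
  by case: (I2_cases i) (I2_cases j) => -> [] -> /=;
    apply: complex_ext; simpc => /=; ring.
- move=> x; rewrite -scalemxAr -scalemxAl mulmxDr mulmxDl mxE [X in _ * X]mxE.
  rewrite form_W mulmx1.
  rewrite -norm2_form -rmorphD -rmorphM ler0c mulr_ge0//.
  rewrite addr_ge0 ?sqr_ge0//.
  have /andP[+ _] := Wform_bounds g (x 0 0) (x 1 0) r0.
  by apply: le_trans; rewrite mulr_ge0 ?subr_ge0 ?(ltW rd)// addr_ge0 ?sqr_ge0.
- rewrite -scalemxAl -scalemxAr scalerA.
  have r2 : r ^+ 2 = d ^+ 2 - 1 by rewrite dd addrC addKr.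
  have diag p q : p ^+ 2 + q ^+ 2 = 1 ->
      s * s * ((d + 1) * (d + 1) + r * r * (p ^+ 2 + q ^+ 2)) = d.
    move=> ->.
    transitivity (s * s * ((d + 1) * (d + 1) + r ^+ 2)); first by ring.
    by rewrite r2 -[RHS]mulr1 -[X in _ = d * X]s2; ring.
  have off p : s * s * ((d + 1) * (r * p) + r * p * (d + 1)) = r * p.
    by rewrite -[RHS]mulr1 -[X in _ = _ * X]s2; ring.
  apply/matrixP => i j; rewrite mxE mxE !big_ord_recl big_ord0 !mxE -/d.
  have := unit_circle_sqr g.
  case: (val g) => p q /= pq.
  case: (I2_cases i) (I2_cases j) => -> [] -> /=;
    apply: complex_ext; simpc => /=;
    by [ring | rewrite -[RHS](diag p q)//; ring | rewrite -[RHS]off; ring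
      | apply: oppr_inj; rewrite opprK -[RHS]off; ring].
Qed.

Lemma sqr_ell2_w r (g : circle R) (x : 'cV[R[i]]_2) : 0 < r ->
  ell2 (w r g) x ^+ 2 = Wform r (val g) (x 0 0) (x 1 0).
Proof.
move=> r0; apply: complexI.
by rewrite ell2_sqrtmx; [exact: form_W | exact: W_sqrtmx_exists].
Qed.

(** The two cross terms are complex conjugates of each other. *)
Lemma Wform_conj r (z u v : R[i]) : Wform r (conjc z) u v = Wform r z v u.
Proof.
rewrite /Wform [normc u ^+ 2 + _]addrC; congr (_ + _ * _).
by case: z u v => p q [a b] [c e] /=; ring.
Qed.

End square_root_weight.

Section factorization.
Variable R : realType.
Implicit Types (p q u v g z : R[i]) (r : R).

(** The Euclidean norm on C^2, encoded as the modulus of |p| + i |q| so that its triangle inequality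
    and definiteness come from those of [normc]. *)
Definition pair_norm p q : R := normc (normc p +i* normc q).

Lemma sqr_pair_norm p q : pair_norm p q ^+ 2 = normc p ^+ 2 + normc q ^+ 2.
Proof. by rewrite /pair_norm [LHS]sqr_normc_ReIm. Qed.

Lemma pair_norm_ge0 p q : 0 <= pair_norm p q.
Proof. exact: normc_ge0. Qed.

Lemma pair_normD p q p' q' :
  pair_norm (p + p') (q + q') <= pair_norm p q + pair_norm p' q'.
Proof.
apply: le_trans (le_normcD _ _).
rewrite -(@ler_pXn2r _ 2) ?nnegrE ?normc_ge0//.
rewrite sqr_pair_norm [leRHS]sqr_normc_ReIm /=.
by apply: lerD; rewrite lerXn2r ?nnegrE ?addr_ge0 ?normc_ge0// le_normcD.
Qed.

Lemma pair_normZ (a : R[i]) p q :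
  pair_norm (a * p) (a * q) = normc a * pair_norm p q.
Proof.
apply/eqP; rewrite -(@eqrXn2 _ 2) ?pair_norm_ge0 ?mulr_ge0 ?normc_ge0//.
by rewrite exprMn !sqr_pair_norm !normcM !exprMn mulrDr.
Qed.

Lemma pair_norm_eq0 p q : pair_norm p q = 0 -> p = 0 /\ q = 0.
Proof. by move=> /eq0_normc[/eq0_normc -> /eq0_normc ->]. Qed.

(** Cauchy-Schwarz, by Lagrange's identity: the difference of squares is (a e - b c)^2. *)
Lemma Re_le_pair_norm p q p' q' :
  Re (p * conjc p' + q * conjc q') <= pair_norm p q * pair_norm p' q'.
Proof.
have conj_norm z : normc (conjc z) = normc z by apply: complexI; exact: normcJ.
apply: (@le_trans _ _ (normc p * normc p' + normc q * normc q')).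
  rewrite raddfD /= -(conj_norm p') -(conj_norm q') -!normcM.
  by apply: lerD; apply: le_trans (ler_norm_Re _); exact: ler_norm.
rewrite -(@ler_pXn2r _ 2) ?nnegrE ?addr_ge0 ?mulr_ge0 ?normc_ge0//.
rewrite exprMn !sqr_pair_norm -subr_ge0.
set a := normc p; set b := normc q; set c := normc p'; set e := normc q'.
by rewrite (_ : _ - _ = (a * e - b * c) ^+ 2) ?sqr_ge0//; ring.
Qed.

Definition sd r : R := Num.sqrt (Num.sqrt (1 + r ^+ 2)).

(* The norm of F(z) (u, v), where F(z) = [[sqrt d, r z / sqrt d],
   [0, 1 / sqrt d]]. *)
Definition F_norm r z u v : R :=
  pair_norm ((sd r)%:C * u + (r / sd r)%:C * z * v) ((sd r)^-1%:C * v).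

Lemma sqr_sd r : sd r ^+ 2 = Num.sqrt (1 + r ^+ 2).
Proof. by rewrite sqr_sqrtr ?sqrtr_ge0. Qed.

Lemma sd_gt0 r : 0 < sd r.
Proof. by rewrite !sqrtr_gt0 ltr_pwDl ?sqr_ge0. Qed.

Lemma sd4 r : sd r ^+ 4 = 1 + r ^+ 2.
Proof. by rewrite (exprM _ 2 2) sqr_sd sqr_sqrtr// addr_ge0 ?sqr_ge0. Qed.

Lemma sqr_F_norm r (g : circle R) u v :
  F_norm r (val g) u v ^+ 2 = Wform r (val g) u v.
Proof.
have sd0 := sd_gt0 r; have sd4 := sd4 r.
rewrite sqr_pair_norm !sqr_normc_ReIm /Wform -sqr_sd !sqr_normc_ReIm.
move: (sd r) sd0 sd4 (unit_circle_sqr g) => s s0 s4.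
case: (val g) u v => p q [a b] [c e] /= pq.
(* m + i n is the product g v, of the same modulus as v. *)
pose m := p * c - q * e; pose n := p * e + q * c.
have mn : m ^+ 2 + n ^+ 2 = c ^+ 2 + e ^+ 2.
  by rewrite -[RHS]mul1r -pq /m /n; ring.
have r2 : r ^+ 2 = s ^+ 4 - 1 by rewrite s4 addrC addKr.
transitivity (s ^+ 2 * (a ^+ 2 + b ^+ 2) + 2 * r * (a * m + b * n) +
  r ^+ 2 / s ^+ 2 * (m ^+ 2 + n ^+ 2) + (c ^+ 2 + e ^+ 2) / s ^+ 2).
  by rewrite /m /n; field; rewrite gt_eqF.
by rewrite mn r2 /m /n; field; rewrite gt_eqF.
Qed.

Lemma E_F_norm r (g : circle R) (x : 'cV[R[i]]_2) : 0 < r ->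
  E r g x = F_norm r (val g) (x 0 0) (x 1 0).
Proof.
move=> r0; apply/eqP.
rewrite -(@eqrXn2 _ 2) ?pair_norm_ge0 ?sqrtr_ge0//.
by rewrite sqr_ell2_w// sqr_F_norm.
Qed.

Lemma Etilde_F_norm r (g : circle R) (x : 'cV[R[i]]_2) : 0 < r ->
  Etilde r g x = F_norm r (val g) (x 1 0) (x 0 0).
Proof.
move=> r0; apply/eqP.
rewrite -(@eqrXn2 _ 2) ?pair_norm_ge0 ?sqrtr_ge0//.
by rewrite /Etilde sqr_ell2_w// sqr_F_norm Wform_conj.
Qed.

End factorization.

(** * The two families satisfy the axioms of an interpolation family *)

Section family.
Variables (R : realType) (r : R) (r0 : 0 < r).
Local Notation d := (Num.sqrt (1 + r ^+ 2)).

Lemma sqr_norm2 (x : 'cV[R[i]]_2) :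
  norm2 x ^+ 2 = normc (x 0 0) ^+ 2 + normc (x 1 0) ^+ 2.
Proof.
rewrite /norm2 sqr_sqrtr ?sumr_ge0// => [|i _]; last exact: sqr_ge0.
rewrite !big_ord_recl big_ord0 addr0.
by congr (_ + normc (x _ _) ^+ 2); exact: val_inj.
Qed.

(** F(z) is triangular with nonzero diagonal, hence injective. The indices (i, j) are (0, 1) for [E]
    and (1, 0) for [Etilde]. *)
Lemma F_norm_is_norm z (i j : 'I_2) : i != j ->
  is_norm (fun x : 'cV[R[i]]_2 => F_norm r z (x i 0) (x j 0)).
Proof.
move=> ij; have s0 := sd_gt0 r; split=> [x y|a x|x].
- rewrite !mxE; apply: le_trans (pair_normD _ _ _ _).
  rewrite /F_norm le_eqVlt; apply/orP; left; apply/eqP.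
  by congr pair_norm; ring.
- rewrite !mxE -pair_normZ; congr pair_norm; ring.
- have sC : (sd r)%:C != 0 by rewrite eq_complex /= gt_eqF.
  move=> /pair_norm_eq0[h1 /eqP].
  rewrite mulf_eq0 eq_complex /= invr_eq0 gt_eqF//= => /eqP xj.
  move: h1; rewrite xj mulr0 addr0 => /eqP.
  rewrite mulf_eq0 (negbTE sC) => /eqP xi.
  apply/matrixP => k l; rewrite (ord1 l) mxE.
  move: ij xi xj.
  by case: (I2_cases i) (I2_cases j) (I2_cases k) => -> [] -> [] -> //.
Qed.

Lemma F_norm_bounds (g : circle R) (u v : R[i]) :
  Num.sqrt (d - r) * Num.sqrt (normc u ^+ 2 + normc v ^+ 2) <=
  F_norm r (val g) u v <=
  Num.sqrt (d + r) * Num.sqrt (normc u ^+ 2 + normc v ^+ 2).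
Proof.
have rd := sqrt1Dsqr_gt r.
have dr : 0 <= d - r by rewrite subr_ge0 ltW.
have dr' : 0 <= d + r by rewrite addr_ge0 ?sqrtr_ge0// ltW.
have F0 : 0 <= F_norm r (val g) u v by exact: pair_norm_ge0.
rewrite -!sqrtrM// -[X in _ <= X <= _](ger0_norm F0) -sqrtr_sqr sqr_F_norm.
have /andP[h1 h2] := Wform_bounds g u v r0.
have W0 : 0 <= Wform r (val g) u v.
  by apply: le_trans h1; rewrite mulr_ge0// addr_ge0 ?sqr_ge0.
by rewrite !ler_wsqrtr.
Qed.

Lemma measurable_F_norm (u v : R[i]) :
  measurable_fun setT (fun g : circle R => F_norm r (val g) u v).
Proof.
have -> : (fun g : circle R => F_norm r (val g) u v) =
    (fun g : circle R => Num.sqrt (Wform r (val g) u v)).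
  by apply/funext => g; rewrite -sqr_F_norm sqrtr_sqr ger0_norm// pair_norm_ge0.
apply: (@measurable_circle_continuous R
  (fun z => Num.sqrt (Wform r z u v))) => g.
have c1 : {for val g,
    continuous (fun z : R[i]^o => z * (v * conjc u) : R[i]^o)}.
  exact: mulrr_continuous.
have c2 := continuous_comp c1 (@continuous_Re R _).
have c3 : {for val g, continuous (fun z : R[i]^o => Wform r z u v)}.
  have c0 (k : R) : {for (val g : R[i]^o), continuous (fun _ : R[i]^o => k)}.
    exact: cst_continuous.
  rewrite (_ : (fun z => _) = (fun=> d * (normc u ^+ 2 + normc v ^+ 2)) +
    (fun=> 2 * r) * (fun z => Re (z * (v * conjc u)))).
    exact: (continuousD (c0 _) (continuousM (c0 _) c2)).
  by apply/funext => z; rewrite /Wform -[z * v * _]mulrA.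
apply: (@continuous_comp _ _ _ (fun z : R[i]^o => Wform r z u v)
  (@Num.sqrt R) (val g : R[i]^o) c3).
exact: sqrt_continuous.
Qed.

Lemma F_norm_family (E' : circle R -> 'cV[R[i]]_2 -> R) (i j : 'I_2) : i != j ->
  (forall g x, E' g x = F_norm r (val g) (x i 0) (x j 0)) ->
  interpolation_family E'.
Proof.
move=> ij E'E; split.
- move=> g; rewrite (_ : E' g = fun x => F_norm r (val g) (x i 0) (x j 0)).
    exact: F_norm_is_norm.
  exact/funext.
- move=> x.
  rewrite (_ : (fun g => _) = fun g => F_norm r (val g) (x i 0) (x j 0)).
    exact: measurable_F_norm.
  exact/funext.
- have rd := sqrt1Dsqr_gt r.
  exists (Num.sqrt (d - r)), (Num.sqrt (d + r)); split.
  + by rewrite sqrtr_gt0 subr_gt0.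
  + by rewrite sqrtr_gt0 addr_gt0// (lt_trans r0).
  + move=> g x; rewrite E'E.
    have -> : norm2 x = Num.sqrt (normc (x i 0) ^+ 2 + normc (x j 0) ^+ 2).
      rewrite -[LHS]ger0_norm ?sqrtr_ge0// -sqrtr_sqr sqr_norm2.
      move: ij.
      by case: (I2_cases i) (I2_cases j) => -> [] -> // _; rewrite addrC.
    exact: F_norm_bounds.
Qed.

End family.

(** * The interpolated norm *)

Section linear_combination.
Variables (K : numFieldType) (p b c : K).

(** This shape covers both the scalar product of F f with F(0) x and the coordinates of the extremal
    function. *)
Lemma derivable_comb (u v : K^o -> K^o) (z : K^o) :
  derivable u z 1 -> derivable v z 1 ->
  derivable (fun w : K^o => p * u w + b * w * v w + c * v w : K^o) z 1.
Proof.
move=> du dv.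
have dZ (k : K) (h : K^o -> K^o) : derivable h z 1 ->
    derivable (fun w => k * h w : K^o) z 1.
  by move=> dh; exact: derivableZ.
apply: (derivableD (f := fun w => p * u w + b * w * v w : K^o)); last exact: dZ.
apply: (derivableD (f := fun w => p * u w : K^o)); first exact: dZ.
apply: (derivableM (f := fun w => b * w : K^o)) => //; exact: dZ.
Qed.

Lemma cvg_comb (T : Type) (F : set_system T) (FF : Filter F) (u s v : T -> K^o)
    (lu ls lv : K^o) : u @ F --> lu -> s @ F --> ls -> v @ F --> lv ->
  (p * u t + b * s t * v t + c * v t : K^o) @[t --> F] -->
  (p * lu + b * ls * lv + c * lv : K^o).
Proof.
move=> hu hs hv; apply: cvgD; last exact: cvgMl_tmp.
apply: cvgD; first exact: cvgMl_tmp.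
by apply: cvgM => //; exact: cvgMl_tmp.
Qed.

End linear_combination.

Section interpolated_norm.
Variables (R : realType) (r : R).
Variables (E' : circle R -> 'cV[R[i]]_2 -> R) (i j : 'I_2) (ij : i != j).
Hypothesis E'E : forall g x, E' g x = F_norm r (val g) (x i 0) (x j 0).
Local Notation d := (Num.sqrt (1 + r ^+ 2)).

Lemma normc_le_norm2 (x : 'cV[R[i]]_2) k : normc (x k 0) <= norm2 x.
Proof.
rewrite -(@ler_pXn2r _ 2) ?nnegrE ?normc_ge0 ?sqrtr_ge0// sqr_norm2.
by case: (I2_cases k) => ->; rewrite ?lerDl ?lerDr sqr_ge0.
Qed.

Lemma norm2_le (x : 'cV[R[i]]_2) : norm2 x <= normc (x 0 0) + normc (x 1 0).
Proof.
rewrite -(@ler_pXn2r _ 2) ?nnegrE ?addr_ge0 ?normc_ge0 ?sqrtr_ge0//.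
rewrite sqr_norm2 sqrrD -addrA lerD2l lerDr.
by rewrite mulrn_wge0// mulr_ge0 ?normc_ge0.
Qed.

Lemma radial_cvg (g : circle R) :
  (t%:C * val g : R[i]^o) @[t --> (1 : R)^'-] --> (val g : R[i]^o).
Proof.
have c1 : (t%:C : R[i]^o) @[t --> (1 : R)^'-] --> (1 : R[i]^o).
  apply/cvgrPdist_lt => e e0.
  have [er er0 e_re] : exists2 k : R, 0 < k & k%:C = e.
    by case: e e0 => a b; rewrite ltcE/= => /andP[/eqP -> a0]; exists a.
  near=> t.
  rewrite -e_re -rmorphB normc_norm ltcR /= expr0n addr0 sqrtr_sqr.
  near: t; apply: (@cvgr_dist_lt _ _ _ _ _ id) => //.
  exact: cvg_at_left_filter.
by rewrite -{2}[val g]mul1r; exact: cvgMr_tmp.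
Unshelve. all: by end_near. Qed.

Lemma interp0_ge (x : 'cV[R[i]]_2) :
  ((F_norm r 0 (x i 0) (x j 0))%:E <= interp0 E' x)%E.
Proof.
set T := F_norm _ _ _ _.
apply: le_ereal_inf_tmp => _ [f [fb [[fD [M fM]] fl f0 ->]]].
pose P := (sd r)%:C; pose B := (r / sd r)%:C; pose C := (sd r)^-1%:C.
pose c1 := conjc (P * x i 0); pose c2 := conjc (C * x j 0).
have T0 : 0 <= T by exact: pair_norm_ge0.
have TE : T = pair_norm (P * x i 0) (C * x j 0).
  by rewrite /T /F_norm mulr0 mul0r addr0.
(* The scalar product of F(z) f(z) with F(0) x; its value at 0 is T^2. *)
pose phi z := (c1 * P) * f z i 0 + (c1 * B) * z * f z j 0 + (c2 * C) * f z j 0.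
have phi_le z u v : Re ((c1 * P) * u + (c1 * B) * z * v + (c2 * C) * v) <=
    F_norm r z u v * T.
  rewrite TE; apply: le_trans (Re_le_pair_norm _ _ _ _).
  rewrite le_eqVlt; apply/orP; left; apply/eqP; congr Re.
  by rewrite -/c1 -/c2; ring.
have phi0 : Re (phi 0) = T ^+ 2.
  rewrite TE sqr_pair_norm /phi f0 mulr0 mul0r addr0.
  rewrite (_ : _ + _ =
    (normc (P * x i 0) ^+ 2 + normc (C * x j 0) ^+ 2)%:C)//.
  rewrite rmorphD !rmorphXn /= -!normc_norm !sqr_normc -/c1 -/c2; ring.
have phiD z : `|z| < 1 -> derivable (phi : R[i]^o -> R[i]^o) z 1.
  by move=> z1; apply: derivable_comb; exact: fD.
pose K := (normc P * M + normc B * M + normc C * M) * T.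
have phiK z : `|z| < 1 -> Re (phi z) <= K.
  move=> z1; apply: le_trans (phi_le _ _ _) _; rewrite ler_wpM2r//.
  apply: le_trans (normc_le_ReIm _) _ => /=.
  rewrite !ger0_norm ?normc_ge0// normcM lerD//.
    apply: le_trans (le_normcD _ _) _; rewrite !normcM -[normc B * _ * _]mulrA.
    have fi := le_trans (normc_le_norm2 (f z) i) (fM _ z1).
    have fj := le_trans (normc_le_norm2 (f z) j) (fM _ z1).
    apply: lerD; rewrite ler_wpM2l ?normc_ge0//.
    apply: le_trans _ fj; rewrite ler_piMl ?normc_ge0//.
    by apply: ltW; rewrite -ltcR -normc_norm.
  by rewrite ler_wpM2l ?normc_ge0// (le_trans (normc_le_norm2 _ _)) ?fM.
have main (y : R) :
    {ae circle_prob R, forall g, ((E' g (fb g))%:E <= y%:E)%E} ->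
    T ^+ 2 <= y * T.
  move=> Ey; rewrite -phi0.
  apply: (radial_limit_bound phiD phiK).
  apply: filterS2 Ey fl => g Egy flg.
  exists ((c1 * P) * fb g i 0 + (c1 * B) * val g * fb g j 0 +
    (c2 * C) * fb g j 0).
    by apply: le_trans (phi_le _ _ _) _; rewrite -E'E ler_wpM2r//.
  by apply: cvg_comb; [exact: flg | exact: radial_cvg | exact: flg].
have mainT (y : R) :
    {ae circle_prob R, forall g, ((E' g (fb g))%:E <= y%:E)%E} ->
    T <= y.
  (* T^2 <= y T can be divided by T only if T != 0. If T = 0, an almost sure bound holds at some
     point, where the norm is nonnegative. *)
  move=> Ey; have [T00|Tn0] := eqVneq T 0.
    have muT : (0 < circle_prob R setT)%E.
      by rewrite [ltRHS](@probability_setT _ _ _ (circle_prob R)) lte_fin.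
    have PF := ae_properfilter_algebraOfSetsType muT.
    have [g] := filter_ex Ey; rewrite lee_fin E'E T00; apply: le_trans.
    exact: pair_norm_ge0.
  have Tp : 0 < T by rewrite lt_neqAle eq_sym Tn0.
  by rewrite -(ler_pM2r Tp) -expr2; exact: main.
(* The essential supremum is an infimum over extended reals. The bound -oo holds at no point, so it
   yields any real bound, here the absurd T - 1. *)
apply: le_ereal_inf_tmp => -[y| |] /= Ey.
- by rewrite lee_fin; exact: mainT.
- exact: leey.
- have : T <= T - 1.
    apply: mainT; apply: filterS Ey => g; rewrite leeNy_eq => /eqP //.
  by rewrite lerDl oppr_ge0 ler10.
Qed.

Lemma interp0_le (x : 'cV[R[i]]_2) :
  (interp0 E' x <= (F_norm r 0 (x i 0) (x j 0))%:E)%E.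
Proof.
(* The solution of F(z) f(z) = F(0) x: the second row fixes the coordinate j, the first gives the
   coordinate i. *)
pose f z : 'cV[R[i]]_2 :=
  \col_k (if k == i then x i 0 - (r / d)%:C * z * x j 0 else x j 0).
have fi z : f z i 0 = x i 0 - (r / d)%:C * z * x j 0 by rewrite mxE eqxx.
have fj z : f z j 0 = x j 0 by rewrite mxE eq_sym (negbTE ij).
have s0 := sd_gt0 r.
have sC : (sd r)%:C != 0 :> R[i] by rewrite eq_complex /= gt_eqF.
have f_norm z : F_norm r z (f z i 0) (f z j 0) = F_norm r 0 (x i 0) (x j 0).
  rewrite /F_norm fi fj; congr pair_norm.
  rewrite -sqr_sd !rmorphM !fmorphV rmorphXn /=; field.
  exact: sC.
have [b fE] : exists b : 'I_2 -> R[i], forall z k,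
    f z k 0 = 1 * x k 0 + b k * z * x j 0 + 0 * x j 0.
  exists (fun k => if k == i then - (r / d)%:C else 0) => z k.
  rewrite mxE; case: eqVneq => [->|ki]; first by ring.
  have -> : k = j.
    move: ij ki.
    by case: (I2_cases i) (I2_cases j) (I2_cases k) => -> [] -> [] ->.
  by ring.
apply: ge_ereal_inf.
exists (ess_sup (circle_prob R) (fun g => (E' g (f (val g)))%:E));
  last by apply/ess_supP; apply: nearW => g; rewrite E'E f_norm.
exists f, (fun g => f (val g)); split.
  - split=> [z k z1|].
      rewrite (_ : (fun u => f u k 0) =
        (fun u => 1 * x k 0 + b k * u * x j 0 + 0 * x j 0)); last exact/funext.
      by apply: (derivable_comb (u := cst (x k 0)) (v := cst (x j 0)));
        exact: derivable_cst.
    pose M k := normc (x k 0) + normc (b k) * normc (x j 0).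
    have fM z k : `|z| < 1 -> normc (f z k 0) <= M k.
      rewrite normc_norm ltcR => z1; rewrite fE mul0r addr0 mul1r.
      apply: le_trans (le_normcD _ _) _; rewrite lerD2l !normcM.
      by rewrite ler_wpM2r ?normc_ge0// ler_piMr ?normc_ge0// ltW.
    exists (M 0 + M 1) => z z1; apply: le_trans (norm2_le _) _.
    by apply: lerD; exact: fM.
  - apply: nearW => g k; rewrite fE; under eq_fun do rewrite fE.
    apply: (@cvg_comb _ _ _ _ _ _ _ (fun=> x k 0) (fun t : R => t%:C * val g)
      (fun=> x j 0)); [exact: cvg_cst | exact: radial_cvg | exact: cvg_cst].
  - apply/matrixP => k l; rewrite (ord1 l) fE; ring.
  - by [].
Qed.

Lemma interp0_F_norm (x : 'cV[R[i]]_2) :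
  interp0 E' x = (F_norm r 0 (x i 0) (x j 0))%:E.
Proof. by apply/eqP; rewrite eq_le interp0_le interp0_ge. Qed.

End interpolated_norm.

(** * The norm of the identity *)

(** With D = d, the squares differ by (D^4 - 1) / D |v|^2, nonnegative because D >= 1. *)
Lemma F_norm0_le (R : realType) (r : R) (u v : R[i]) :
  F_norm r 0 u v <= Num.sqrt (1 + r ^+ 2) * F_norm r 0 v u.
Proof.
rewrite /F_norm !mulr0 !mul0r !addr0 -sqr_sd.
have s1 : 1 <= sd r ^+ 2.
  by rewrite sqr_sd -[leLHS]sqrtr1 ler_wsqrtr// lerDl sqr_ge0.
have s0 := sd_gt0 r.
rewrite -(@ler_pXn2r _ 2) ?nnegrE ?mulr_ge0 ?pair_norm_ge0 ?sqr_ge0 ?(ltW s0)//.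
rewrite exprMn !sqr_pair_norm !normcM !exprMn.
have nC (k : R) : normc k%:C ^+ 2 = k ^+ 2.
  by rewrite sqr_normc_ReIm /= expr0n addr0.
rewrite !nC exprVn; move: (sd r ^+ 2) s1 => D D1.
have D0 : 0 < D by apply: lt_le_trans D1.
rewrite -subr_ge0 (_ : _ - _ = (D ^+ 4 - 1) / D * normc v ^+ 2); last first.
  by field; rewrite gt_eqF.
rewrite mulr_ge0 ?sqr_ge0// divr_ge0 ?(ltW D0)//.
by rewrite subr_ge0 exprn_ege1.
Qed.

Theorem corollary2p4 (R : realType) (r : R) (hr : 0 < r) :
  [/\ interpolation_family (E r),
      interpolation_family (Etilde r),
      rearrangement (@conj_circle R) (Etilde r) (E r) &
      opnorm (interp0 (Etilde r)) (interp0 (E r)) idfun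
      = (Num.sqrt (1 + r ^+ 2))%:E].
Proof.
have Ew g x := E_F_norm g x hr.
have Etw g x := Etilde_F_norm g x hr.
split.
- exact: (F_norm_family hr (i := 0) (j := 1)).
- exact: (F_norm_family hr (i := 1) (j := 0)).
- by split=> //; exact: measure_preserving_conj_circle.
- have iE x := interp0_F_norm (i := 0) (j := 1) isT Ew x.
have iEt x := interp0_F_norm (i := 1) (j := 0) isT Etw x.
have d0 : 0 <= Num.sqrt (1 + r ^+ 2) by exact: sqrtr_ge0.
apply/eqP; rewrite eq_le; apply/andP; split.
  apply: ge_ereal_sup => _ [x /= + <-]; rewrite iE iEt !lee_fin => x1.
  by apply: le_trans (F_norm0_le _ _ _) _; rewrite ler_piMr.
apply: ereal_sup_ubound.
have s0 := sd_gt0 r.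
have pn0 (p : R[i]) : pair_norm p 0 = normc p /\ pair_norm 0 p = normc p.
  by split; apply/eqP; rewrite -(@eqrXn2 _ 2) ?pair_norm_ge0 ?normc_ge0//;
    rewrite sqr_pair_norm normc0 expr0n ?addr0 ?add0r.
(* The vector (1, 0) scaled by sqrt d has norm 1 in the first space and sqrt d sqrt d = d in the
   second. *)
exists (\col_k (if k == 0 then (sd r)%:C else 0)).
  rewrite /= iEt !mxE /= /F_norm !mulr0 mul0r addr0 (pn0 _).2 -rmorphM.
  by rewrite mulVf ?gt_eqF// normc1.
rewrite /= iE !mxE /= /F_norm !mulr0 addr0 (pn0 _).1 -rmorphM -expr2 sqr_sd.
by rewrite /= expr0n addr0 sqrtr_sqr ger0_norm.
Qed.
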